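(* Let $p$ be an odd prime, write $p-1=2^sq$ with $q$ odd, set $r=\frac{p-1}{2}$ and $d=2^{s-1}$ (so $r=dq$). Let $\gamma$ be a generator of $\mathbb{F}_p^\times$, let $\epsilon\in\{\pm1\}^r$, and let $f_\epsilon\in\mathbb{F}_p[x]$ be the unique polynomial of degree $<r$ with $f_\epsilon(\gamma^{2n})=\epsilon_n\gamma^n$ for $0\le n<r$. Then, working modulo $x^r-1$, $$f_\epsilon\text{ is a Tonelli--Shanks polynomial}\iff a(\epsilon)=d=2^{s-1},$$ where $a(\epsilon)$ is the alternating order of $\epsilon$. Equivalently, $f_\epsilon$ is (modulo $x^r-1$) a Tonelli--Shanks polynomial if and only if $$\epsilon_{dx+y}=(-1)^x\epsilon_y\qquad\text{for all }0\le x<q,\ 0\le y<d.$$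
   Context: Alternating order: the flip shift is the map $\sigma:\{\pm1\}^r\to\{\pm1\}^r$, $\sigma(\epsilon_0,\dots,\epsilon_{r-1})=(\epsilon_1,\dots,\epsilon_{r-1},-\epsilon_0)$; the orbit of $\epsilon$ is $\mathcal{O}_\epsilon=\{\sigma^n(\epsilon):n\in\mathbb{Z}\}$, and $a(\epsilon)=|\mathcal{O}_\epsilon|/2$. Tonelli--Shanks polynomials: fix a primitive $2^{s-1}$-st root of unity $\zeta\in\mathbb{F}_p$ and a square root $\zeta^{1/2}\in\mathbb{F}_p$ of it; write $\zeta^{-k/2}=(\zeta^{1/2})^{-k}$ and $f_k(x)=\zeta^{-k/2}x^{\frac{q+1}{2}}$ for $0\le k\le 2^{s-1}-1$. A Tonelli--Shanks polynomial is any polynomial of the form $$\sum_{k=0}^{2^{s-1}-1}h_k\,f_k(x)\prod_{\substack{0\le i\le 2^{s-1}-1\\ i\ne k}}\frac{x^q-\zeta^i}{\zeta^k-\zeta^i},\qquad h_k\in\{\pm1\}.$$ Polynomials are identified modulo $x^r-1$: ''$f_\epsilon$ is a Tonelli--Shanks polynomial modulo $x^r-1$'' means that $f_\epsilon$ is congruent modulo $x^r-1$ to some Tonelli--Shanks polynomial. *)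

(* Defs.v *)
From HB Require Import structures.
From mathcomp Require Import all_boot all_fingroup all_algebra all_solvable.
Set Implicit Arguments. Unset Strict Implicit. Unset Printing Implicit Defensive.
Import GRing.Theory.
Local Open Scope ring_scope.

(* Signs are taken inside the ring R (in the application R = 'F_p with p odd, *)
(* so that 1 and -1 are distinct and {1, -1} is a faithful copy of {±1}).     *)
Definition is_sign (R : nzRingType) (u : R) : Prop := u = 1 \/ u = -1.

Definition sign_vector (R : nzRingType) (r : nat) (e : r.-tuple R) : Prop :=
  forall u, u \in (e : seq R) -> is_sign u.

(* The flip shift (e_0, ..., e_(r-1)) |-> (e_1, ..., e_(r-1), - e_0).  It is   *)
(* defined on all of R^r and preserves the sign vectors (flip_sign below).    *)
Definition flip (R : nzRingType) (r : nat) (e : r.-tuple R) : r.-tuple R :=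
  [tuple if (i.+1 < r)%N then e`_i.+1 else - e`_0 | i < r].

Lemma nth_flip (R : nzRingType) r (e : r.-tuple R) i : (i < r)%N ->
  (flip e)`_i = if (i.+1 < r)%N then e`_i.+1 else - e`_0.
Proof. by move=> lti; rewrite -[i]/(val (Ordinal lti)) -tnth_nth tnth_mktuple. Qed.

Lemma flip_sign (R : nzRingType) r (e : r.-tuple R) :
  sign_vector e -> sign_vector (flip e).
Proof.
move=> he u /(nthP 0)[i]; rewrite size_tuple => lti <-; rewrite nth_flip //.
have es j : (j < r)%N -> is_sign e`_j by move=> ltj; apply/he/mem_nth; rewrite size_tuple.
case: ifP => [/es //|_]; case: (es 0%N (leq_ltn_trans (leq0n i) lti)) => ->.
  by right.
by left; rewrite opprK.
Qed.

Lemma flip_inj (R : nzRingType) r : injective (@flip R r).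
Proof.
move=> e1 e2 eq12; apply/val_inj/(@eq_from_nth _ 0); rewrite ?size_tuple // => i lti.
have r_gt0 : (0 < r)%N := leq_ltn_trans (leq0n i) lti.
case: i lti => [_|i lti].
  have := congr1 (fun t : r.-tuple R => t`_r.-1) eq12.
  by rewrite /= !nth_flip ?prednK ?ltnn //; apply: oppr_inj.
have := congr1 (fun t : r.-tuple R => t`_i) eq12.
by rewrite /= !nth_flip ?lti // ltnW.
Qed.

Definition flip_perm (R : finNzRingType) (r : nat) : {perm r.-tuple R} :=
  perm (@flip_inj R r).

(* porbit (flip_perm R r) e is the orbit of e under the cyclic group          *)
(* generated by the flip shift.                                               *)
Definition alternating_order (R : finNzRingType) (r : nat) (e : r.-tuple R) : nat :=
  #|porbit (flip_perm R r) e|./2.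

Section TonelliShanks.
Variables (F : fieldType) (d q : nat).
(* zh is the chosen square root of z *)
Variables (z zh : F).

Definition ts_branch (k : nat) : {poly F} := zh ^- k *: 'X^(q.+1./2).

Definition ts_poly (h : 'I_d -> F) : {poly F} :=
  \sum_(k < d) h k *: (ts_branch k *
    \prod_(i < d | i != k) ((z ^+ k - z ^+ i)^-1 *: ('X^q - (z ^+ i)%:P))).

Definition tonelli_shanks (f : {poly F}) : Prop :=
  exists2 h : 'I_d -> F, (forall k, is_sign (h k)) & f = ts_poly h.

Definition tonelli_shanks_mod (r : nat) (f : {poly F}) : Prop :=
  exists2 g, tonelli_shanks g & 'X^r - 1 %| f - g.

End TonelliShanks.

Definition interpolant (F : fieldType) (r : nat) (g : F) (e : r.-tuple F)
    (f : {poly F}) : Prop :=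
  (size f <= r)%N /\ forall n, (n < r)%N -> f.[g ^+ (2 * n)] = e`_n * g ^+ n.

Lemma interpolant_exists_unique (F : fieldType) (r : nat) (g : F) (e : r.-tuple F) :
  (2 * r).-primitive_root g -> exists! f, interpolant g e f.
Proof.
move=> prg; pose x (i : 'I_r) := g ^+ (2 * i).
have x_inj : injective x.
  move=> i j /eqP; rewrite /x (eq_prim_root_expr prg) !modn_small ?ltn_pmul2l //.
  by rewrite eqn_pmul2l // => /eqP/val_inj.
pose l (i : 'I_r) := \prod_(j < r | j != i) ((x i - x j)^-1 *: ('X - (x j)%:P)).
have lE i j : (l i).[x j] = (i == j)%:R.
  rewrite horner_prod; case: eqP => [<-|/eqP ij].
    rewrite big1 // => k ki; rewrite hornerZ hornerXsubC mulVf // subr_eq0.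
    by rewrite (inj_eq x_inj) eq_sym.
  by rewrite (bigD1 j) 1?eq_sym //= hornerZ hornerXsubC subrr mulr0 mul0r.
have sl i : (size (l i) <= r)%N.
  rewrite /l scaler_prod; apply: leq_trans (size_scale_leq _ _) _.
  rewrite -big_filter size_prod_XsubC size_filter.
  have -> : count (fun j => j != i) (index_enum 'I_r) = #|predC1 i|.
    by rewrite cardE /enum_mem size_filter [index_enum _]unlock; apply: eq_count.
  by rewrite cardC1 card_ord prednK // (leq_ltn_trans _ (ltn_ord i)).
pose P := \sum_(i < r) (e`_i * g ^+ i) *: l i.
have [sP PE] : interpolant g e P.
  split.
    apply: leq_trans (size_sum _ _ _) _; apply/bigmax_leqP => i _.
    exact: leq_trans (size_scale_leq _ _) (sl i).
  move=> n ltn; rewrite horner_sum (bigD1 (Ordinal ltn)) //= hornerZ.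
  rewrite -[g ^+ (2 * n)]/(x (Ordinal ltn)) lE eqxx mulr1 big1 ?addr0 // => i.
  by move=> /negPf ni; rewrite hornerZ lE ni mulr0.
exists P; split=> // f [sf fE]; apply/eqP; rewrite -subr_eq0; apply: contraT => nz.
have := max_poly_roots (rs := [seq x i | i <- enum 'I_r]) nz.
rewrite size_map size_enum_ord map_inj_uniq ?enum_uniq // => /(_ _ isT).
rewrite ltnNge (leq_trans (size_polyD _ _)) ?size_polyN ?geq_max ?sP ?sf //.
apply; apply/allP => _ /mapP[i _ ->].
by rewrite rootE hornerD hornerN fE // PE // subrr.
Qed.

(* Main.v *)
Require Import Defs.
From HB Require Import structures.
From mathcomp Require Import all_boot all_fingroup all_algebra all_solvable.
From mathcomp Require Import finfield.
Set Implicit Arguments. Unset Strict Implicit. Unset Printing Implicit Defensive.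
Import GRing.Theory.
Local Open Scope ring_scope.

(** On the nodes g^(2n) the power x^q runs through the d-th roots of unity, and
    which root zeta^k it is depends only on n mod d, bijectively.  A
    Tonelli-Shanks polynomial therefore takes the value h_k c_n g^n at g^(2n),
    where c_n = zeta^(-k/2) g^(nq) is a sign with c_(n+d) = - c_n because
    g^(dq) = -1; the h_k being free signs, this leaves exactly the condition
    e_(dx+y) = (-1)^x e_y.

    On the other side, extend e to an r-antiperiodic sequence E.  The orbit size
    N is the least period of E; it divides 2dq but not dq, hence 2d divides N as
    d is a power of 2 and q is odd.  So N = 2d iff 2d is a period, iff E is
    d-antiperiodic (reduce r = dq modulo 2d), iff e satisfies the condition. *)

(** * Orbit sizes and divisibility *)

Lemma dvdn_card_porbit (T : finType) (s : {perm T}) (x : T) (m : nat) :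
  (#|porbit s x| %| m)%N <-> iter m s x = x.
Proof.
set N := #|porbit s x|.
have N_gt0 : (0 < N)%N by apply/card_gt0P; exists x; apply: porbit_id.
have iterN k : iter (k * N) s x = x.
  by elim: k => // k IHk; rewrite mulSn iterD IHk iter_porbit.
have iter_mod : iter m s x = iter (m %% N) s x.
  by rewrite [in LHS](divn_eq m N) addnC iterD iterN.
split=> [/dvdnP[k ->] | ]; first exact: iterN.
rewrite iter_mod => mod_fix.
have ltN : (m %% N < N)%N by rewrite ltn_mod.
(* The first [N] iterates of [x] are distinct, so an iterate of index below [N] that returns to [x]
   has index 0. *)
have := uniq_traject_porbit s x; rewrite -/N => /(nth_uniq x).
move=> /(_ (m %% N)%N 0%N); rewrite !size_traject => /(_ ltN N_gt0).
by rewrite !nth_traject //= mod_fix eqxx /dvdn => /esym.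
Qed.

(** Otherwise the [p]-part of [N] divides [p ^ s.-1], while its part prime to [p] divides [q] by
    Gauss, and the excluded divisibility follows. *)
Lemma dvdn_pfactor_maximal (p s q N : nat) : prime p -> (0 < s)%N -> (0 < q)%N ->
  (N %| p ^ s * q)%N -> ~~ (N %| p ^ s.-1 * q)%N -> (p ^ s %| N)%N.
Proof.
move=> p_pr s_gt0 q_gt0 dvdN ndvdN.
have N_gt0 : (0 < N)%N.
  by apply: dvdn_gt0 dvdN; rewrite muln_gt0 expn_gt0 prime_gt0.
rewrite pfactor_dvdn // leqNgt; apply: contra ndvdN => lts.
have [m co_pm N_eq] := pfactor_coprime p_pr N_gt0.
rewrite N_eq mulnC dvdn_mul //; first by rewrite dvdn_exp2l // -ltnS prednK.
rewrite -(@Gauss_dvdr m (p ^ s)) ?coprimeXr 1?coprime_sym //.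
by apply: dvdn_trans dvdN; rewrite [X in (_ %| X)%N]N_eq dvdn_mulr.
Qed.

Lemma ltn_block (d q x y : nat) : (x < q)%N -> (y < d)%N -> (d * x + y < d * q)%N.
Proof.
move=> ltx lty; apply: (@leq_trans (d * x.+1)).
  by rewrite mulnS addnC ltn_add2r.
by rewrite leq_mul2l ltx orbT.
Qed.

(** * Periods of the antiperiodic extension and the alternating order *)

Section AlternatingOrder.
Variables (R : finNzRingType) (r : nat) (e : r.-tuple R).
Hypothesis r_gt0 : (0 < r)%N.

(* The r-antiperiodic extension of e to all indices: the flip shift is the
   restriction to windows of length r of the shift of this sequence. *)
Definition flip_ext (n : nat) : R := (-1) ^+ (n %/ r) * e`_(n %% r).

Lemma flip_ext_small n : (n < r)%N -> flip_ext n = e`_n.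
Proof. by move=> ltn; rewrite /flip_ext divn_small // modn_small // mul1r. Qed.

Lemma flip_extD n : flip_ext (n + r) = - flip_ext n.
Proof. by rewrite /flip_ext divnDr // divnn r_gt0 modnDr addn1 exprS mulN1r mulNr. Qed.

Lemma flip_extDM n k : flip_ext (n + r * k) = (-1) ^+ k * flip_ext n.
Proof.
elim: k => [|k IHk]; first by rewrite muln0 addn0 mul1r.
by rewrite mulnS addnCA addnC flip_extD IHk exprS mulN1r mulNr.
Qed.

Lemma flip_ext_edivn n m :
  flip_ext (n + m) = (-1) ^+ (n %/ r) * flip_ext (n %% r + m).
Proof. by rewrite -flip_extDM addnAC [in LHS](divn_eq n r) mulnC [(r * _ + _)%N]addnC. Qed.

Lemma flip_ext_edivn0 n : flip_ext n = (-1) ^+ (n %/ r) * flip_ext (n %% r).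
Proof. by rewrite -[in LHS](addn0 n) flip_ext_edivn addn0. Qed.

Lemma nth_iter_flip m i : (i < r)%N -> (iter m (@flip R r) e)`_i = flip_ext (i + m).
Proof.
elim: m i => [|m IHm] i lti; first by rewrite addn0 flip_ext_small.
rewrite iterS nth_flip //; case: ltnP => [lt|ge]; first by rewrite IHm // addSnnS.
rewrite IHm //.
have -> : (i + m.+1 = 0 + m + r)%N.
  by rewrite addnS -addSn add0n addnC; congr addn; apply/eqP; rewrite eqn_leq lti.
by rewrite flip_extD.
Qed.

(** The [m]-th iterate is the window of the extension starting at [m]. Antiperiodicity multiplies
    both sides by the same sign, so agreement on one window spreads to all indices. *)
Lemma iter_flip_fixP m :
  iter m (flip_perm R r) e = e <-> forall n, flip_ext (n + m) = flip_ext n.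
Proof.
have -> : iter m (flip_perm R r) e = iter m (@flip R r) e.
  by apply: eq_iter => t; rewrite permE.
split=> [fix_e n | per].
  rewrite flip_ext_edivn [RHS]flip_ext_edivn0; congr (_ * _).
  by rewrite -nth_iter_flip ?ltn_mod // fix_e flip_ext_small // ltn_mod.
apply/val_inj/(@eq_from_nth _ 0); rewrite ?size_tuple // => i lti.
by rewrite nth_iter_flip // per flip_ext_small.
Qed.

Lemma flip_ext_antiperiodP d q : r = (d * q)%N -> odd q ->
  (forall n, flip_ext (n + d) = - flip_ext n) <->
  (forall x y, (x < q)%N -> (y < d)%N -> e`_(d * x + y) = (-1) ^+ x * e`_y).
Proof.
move=> r_eq q_odd.
have lt_r x y : (x < q)%N -> (y < d)%N -> (d * x + y < r)%N.
  by rewrite r_eq; apply: ltn_block.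
have q_gt0 : (0 < q)%N by case: (q) q_odd.
have d_gt0 : (0 < d)%N by move: r_gt0; rewrite r_eq muln_gt0 => /andP[].
have lt_r0 y : (y < d)%N -> (y < r)%N.
  by move=> lty; have := lt_r 0%N y q_gt0 lty; rewrite muln0.
split=> [anti x y ltx lty | blocks n].
  rewrite -!flip_ext_small ?lt_r ?lt_r0 //.
  elim: {ltx} x => [|x IHx]; first by rewrite muln0 mul1r.
  by rewrite mulnS -addnA addnC anti IHx exprS mulN1r mulNr.
have flip_ext_block x y : (x < q)%N -> (y < d)%N ->
    flip_ext (d * x + y) = (-1) ^+ x * flip_ext y.
  by move=> ltx lty; rewrite !flip_ext_small ?lt_r ?lt_r0 ?blocks.
rewrite flip_ext_edivn [in RHS]flip_ext_edivn0 -mulrN; congr (_ * _).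
move: (n %% r)%N (ltn_pmod n r_gt0) => b ltb.
have ltx : (b %/ d < q)%N by rewrite ltn_divLR // mulnC -r_eq.
have lty : (b %% d < d)%N by rewrite ltn_mod.
rewrite (divn_eq b d) mulnC addnAC -mulnSr [in RHS]flip_ext_block //.
(* Only the last block can leave the window. There the wrap past [r] contributes the minus sign, and
   [(-1) ^+ (b %/ d)] is 1 because [b %/ d = q - 1] is even. *)
case: (ltnP (b %/ d).+1 q) => [ltSx | geSx].
  by rewrite flip_ext_block // exprS mulN1r mulNr.
have q_eq : q = (b %/ d).+1 by apply/eqP; rewrite eqn_leq ltx geSx.
rewrite -q_eq -r_eq addnC flip_extD -signr_odd.
by move: q_odd; rewrite q_eq /= => /negPf->; rewrite mul1r.
Qed.

Lemma alternating_orderP s q : (0 < s)%N -> odd q -> r = (2 ^ s.-1 * q)%N ->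
    e`_0 != - e`_0 ->
  alternating_order e = (2 ^ s.-1)%N <->
  (forall n, flip_ext (n + 2 ^ s.-1) = - flip_ext n).
Proof.
move=> s_gt0 q_odd r_eq e0_neq.
set d := (2 ^ s.-1)%N in r_eq *.
have d_gt0 : (0 < d)%N by rewrite expn_gt0.
have q_gt0 : (0 < q)%N by case: (q) q_odd.
have ds_eq : (2 ^ s = 2 * d)%N by rewrite /d -expnS prednK.
rewrite /alternating_order; set N := #|_|.
have perP m : (N %| m)%N <-> forall n, flip_ext (n + m) = flip_ext n.
  by split=> [/dvdn_card_porbit/iter_flip_fixP | /iter_flip_fixP/dvdn_card_porbit].
have dvdN : (2 * d %| N)%N.
  rewrite -ds_eq; apply: (@dvdn_pfactor_maximal 2 s q) => //.
    apply/perP => n; rewrite ds_eq -mulnA -r_eq mulnC flip_extDM.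
    by rewrite sqrrN expr1n mul1r.
  (* A period [r] would, at index 0, give [e_0 = - e_0] by antiperiodicity. *)
  apply/negP; rewrite -/d -r_eq => /perP/(_ 0%N)/esym/eqP; rewrite flip_extD.
  by rewrite flip_ext_small //; apply/negP.
(* [N] is even, so halving is exact; with [2d] dividing [N], only the reverse divisibility is left
   to express. *)
have half_eq : N./2 = d <-> (N %| 2 * d)%N.
  split=> [N_eq | Ndvd].
    have [k Nk] := dvdnP dvdN; rewrite -N_eq Nk mulnCA mul2n doubleK -mul2n.
    by rewrite mulnCA.
  suff -> : N = (2 * d)%N by rewrite mul2n doubleK.
  by apply/eqP; rewrite eqn_dvd Ndvd.
split=> [/half_eq/perP per n | anti]; last first.
  by apply/half_eq/perP => n; rewrite mul2n -addnn addnA !anti opprK.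
(* Since [q] is odd, [r = d + 2d * q./2]: modulo the period [2d], a shift by [d] is a shift by [r],
   which changes the sign. *)
have perM k : flip_ext (n + d + 2 * d * k) = flip_ext (n + d).
  by elim: k => [|k IHk]; rewrite ?muln0 ?addn0 // mulnS addnCA addnC per.
rewrite -(perM q./2) -flip_extD r_eq; congr flip_ext.
rewrite -addnA -[in RHS](odd_double_half q) q_odd -mul2n mulnDr muln1.
by rewrite [in RHS]mulnCA mulnA.
Qed.

End AlternatingOrder.

(** * Congruence modulo [X^n - 1] and signs as square roots of 1 *)

Lemma dvdp_Xn_sub1P (F : fieldType) (n : nat) (w : F) (u : {poly F}) :
  n.-primitive_root w ->
  'X^n - 1 %| u <-> forall i, (i < n)%N -> u.[w ^+ i] = 0.
Proof.
move=> w_prim; split=> [/dvdpP[v ->] i lti | roots_u].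
  rewrite !hornerE -exprM mulnC exprM (prim_expr_order w_prim).
  by rewrite expr1n subrr mulr0.
(* [X^n - 1] is the product of the pairwise distinct factors [X - w^i]. *)
rewrite -(factor_Xn_sub_1 w_prim).
rewrite -(big_map (fun i => w ^+ i) xpredT (fun x => 'X - x%:P)).
apply: uniq_roots_dvdp; last first.
  rewrite uniq_rootsE map_inj_in_uniq ?iota_uniq // => i j.
  rewrite !mem_index_iota /= => lti ltj /eqP.
  by rewrite (eq_prim_root_expr w_prim) !modn_small // => /eqP.
apply/allP => _ /mapP[i + ->]; rewrite mem_index_iota /= => lti.
by apply/rootP/roots_u.
Qed.

Lemma is_signP (F : fieldType) (u : F) : is_sign u <-> u ^+ 2 = 1.
Proof.
split=> [[]-> | /eqP]; rewrite ?sqrrN ?expr1n //.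
by rewrite sqrf_eq1 => /orP[]/eqP->; [left | right].
Qed.

Lemma prim_root_neq0 (R : nzRingType) (n : nat) (w : R) :
  n.-primitive_root w -> w != 0.
Proof. by move=> w_prim; rewrite (prim_root_eq0 w_prim) -lt0n (prim_order_gt0 w_prim). Qed.

(** * Values of Tonelli-Shanks polynomials at the nodes [g^(2n)] *)

Section TonelliShanksValues.
Variables (F : fieldType) (d q r : nat) (z zh g : F).
Hypothesis z_prim : d.-primitive_root z.
Hypothesis zh_sqr : zh ^+ 2 = z.
Hypothesis g_prim : (2 * r).-primitive_root g.
Hypothesis r_eq : r = (d * q)%N.
Hypothesis q_odd : odd q.

(** The products are the Lagrange basis in the variable [x^q] for the nodes [z^i], so only the
    [k]-th branch survives. *)
Lemma horner_ts_poly (h : 'I_d -> F) (x : F) (k : 'I_d) : x ^+ q = z ^+ k ->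
  (ts_poly q z zh h).[x] = h k * (zh ^- k * x ^+ (q.+1./2)).
Proof.
move=> xq; rewrite horner_sum (bigD1 k) //= [X in _ + X]big1 ?addr0 => [|j jk].
  rewrite hornerZ hornerM hornerZ hornerXn horner_prod big1 ?mulr1 // => i ik.
  rewrite !hornerE xq mulVf // subr_eq0 (eq_prim_root_expr z_prim).
  by rewrite !modn_small // eq_sym.
rewrite hornerZ hornerM horner_prod (bigD1 k) 1?eq_sym //=.
by rewrite !hornerZ hornerD hornerN hornerC !hornerXn xq subrr !(mulr0, mul0r).
Qed.

Lemma ts_node_root n : (g ^+ (2 * n * q)) ^+ d = 1.
Proof.
rewrite -exprM -mulnA [(q * d)%N]mulnC -r_eq mulnAC exprM.
by rewrite (prim_expr_order g_prim) expr1n.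
Qed.

(** The discrete logarithm to base [z] of the [q]-th power of the node [g^(2n)]; it selects the
    branch used there. *)
Definition ts_index n : 'I_d := sval (prim_rootP z_prim (ts_node_root n)).

Lemma ts_indexE n : g ^+ (2 * n * q) = z ^+ ts_index n.
Proof. exact: svalP (prim_rootP z_prim (ts_node_root n)). Qed.

Lemma gen_expr_half : g ^+ r = -1.
Proof.
have r_gt0 : (0 < r)%N by have := prim_order_gt0 g_prim; rewrite muln_gt0.
apply/eqP; have /eqP := prim_expr_order g_prim.
rewrite mulnC exprM sqrf_eq1 => /orP[|//].
by rewrite -(prim_order_dvd g_prim) => /(dvdn_leq r_gt0); rewrite leqNgt ltn_Pmull.
Qed.

Lemma ts_index_block x y : ts_index (d * x + y) = ts_index y.
Proof.
apply/val_inj/eqP; rewrite /= -[val _](modn_small (ltn_ord _)).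
rewrite -[X in _ == X](modn_small (ltn_ord _)) -(eq_prim_root_expr z_prim) -!ts_indexE.
have -> : (2 * (d * x + y) * q = 2 * r * x + 2 * y * q)%N.
  by rewrite r_eq mulnDr mulnDl !mulnA; congr addn; rewrite mulnAC.
by rewrite exprD exprM (prim_expr_order g_prim) expr1n mul1r.
Qed.

(** The order is [2r / 2q = d], so the powers with exponent [y < d] meet each [d]-th root of unity
    once; this makes [ts_index] bijective on [y < d]. *)
Lemma ts_index_prim : d.-primitive_root (g ^+ (2 * q)).
Proof.
have dvd_d : (d %| 2 * r)%N by rewrite r_eq mulnCA dvdn_mulr.
have := dvdn_prim_root g_prim dvd_d; rewrite r_eq mulnCA mulKn //.
exact: prim_order_gt0 z_prim.
Qed.

Lemma ts_index_inj y y' : (y < d)%N -> (y' < d)%N -> ts_index y = ts_index y' -> y = y'.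
Proof.
move=> lty lty' /(congr1 (fun k : 'I_d => z ^+ k)); rewrite -!ts_indexE.
rewrite ![(2 * _ * q)%N]mulnAC !(exprM g (2 * q)) => /eqP.
by rewrite (eq_prim_root_expr ts_index_prim) !modn_small // => /eqP.
Qed.

(** A sigma type rather than [exists], so that the preimage can be extracted as data to define
    [h]. *)
Lemma ts_index_surj k : {y | (y < d)%N & ts_index y = k}.
Proof.
have zk_root : (z ^+ k) ^+ d = 1 by rewrite exprAC (prim_expr_order z_prim) expr1n.
have [y y_eq] := prim_rootP ts_index_prim zk_root.
exists y => //; apply/val_inj/eqP => /=.
rewrite -[val _](modn_small (ltn_ord _)) -[X in _ == X](modn_small (ltn_ord _)).
by rewrite -(eq_prim_root_expr z_prim) -ts_indexE mulnAC exprM y_eq.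
Qed.

(** The ratio of the selected branch at [g^(2n)] to [g^n]: the branch contains
    [g^(n(q+1)) = g^(nq) * g^n]. *)
Definition ts_sign n : F := zh ^- ts_index n * g ^+ (n * q).

Lemma ts_sign_sqr n : ts_sign n ^+ 2 = 1.
Proof.
rewrite exprMn exprVn -exprM mulnC exprM zh_sqr -exprM mulnC mulnA ts_indexE mulVf //.
by rewrite expf_neq0 // (prim_root_neq0 z_prim).
Qed.

Lemma ts_sign_block x y : ts_sign (d * x + y) = (-1) ^+ x * ts_sign y.
Proof.
rewrite /ts_sign ts_index_block mulnDl mulnAC -r_eq exprD exprM gen_expr_half.
by rewrite mulrCA.
Qed.

Lemma horner_ts_poly_node (h : 'I_d -> F) n :
  (ts_poly q z zh h).[g ^+ (2 * n)] = h (ts_index n) * ts_sign n * g ^+ n.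
Proof.
rewrite (@horner_ts_poly _ _ (ts_index n)) -?exprM ?ts_indexE // -!mulrA.
congr (_ * (_ * _)); rewrite -exprD -mulnSr [(2 * n)%N]mulnC -mulnA mul2n.
by have := odd_double_half q.+1; rewrite /= q_odd add0n => ->.
Qed.

Lemma tonelli_shanks_modP (e : r.-tuple F) (f : {poly F}) :
    sign_vector e -> interpolant g e f ->
  tonelli_shanks_mod d q z zh r f <->
  (forall x y, (x < q)%N -> (y < d)%N -> e`_(d * x + y) = (-1) ^+ x * e`_y).
Proof.
move=> e_sign [_ fE].
have g_neq0 n : g ^+ n != 0 by rewrite expf_neq0 // (prim_root_neq0 g_prim).
have q_gt0 : (0 < q)%N by case: (q) q_odd.
have d_gt0 := prim_order_gt0 z_prim.
have lt_r x y : (x < q)%N -> (y < d)%N -> (d * x + y < r)%N.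
  by rewrite r_eq; apply: ltn_block.
have lt_r0 y : (y < d)%N -> (y < r)%N.
  by move=> lty; have := lt_r 0%N y q_gt0 lty; rewrite muln0.
have x_prim : r.-primitive_root (g ^+ 2).
  have r_gt0 : (0 < r)%N by rewrite r_eq muln_gt0 d_gt0.
  by have := dvdn_prim_root g_prim (dvdn_mull 2 (dvdnn r)); rewrite mulnK.
have congrP h : 'X^r - 1 %| f - ts_poly q z zh h <->
    forall n, (n < r)%N -> e`_n = h (ts_index n) * ts_sign n.
  apply: iff_trans (dvdp_Xn_sub1P _ x_prim) _.
  split=> E n ltn; move/(_ n ltn): E.
    rewrite -exprM hornerD hornerN fE // horner_ts_poly_node => /eqP; rewrite subr_eq0.
    by move/eqP/(mulIf (g_neq0 n)).
  by rewrite -exprM hornerD hornerN fE // horner_ts_poly_node => ->; rewrite subrr.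
split=> [[_ [h _ ->] /congrP eE] x y ltx lty | blocks].
  by rewrite !eE ?lt_r ?lt_r0 // ts_index_block ts_sign_block mulrCA.
(* The choice is forced: [e_y = h_k * ts_sign y] at the [y < d] of index [k], and [ts_sign y] is its
   own inverse. *)
pose h k := let y := s2val (ts_index_surj k) in e`_y * ts_sign y.
have hE y : (y < d)%N -> h (ts_index y) = e`_y * ts_sign y.
  move=> lty; rewrite /h; case: ts_index_surj => y' /= lty' eqk.
  by rewrite (ts_index_inj lty' lty eqk).
exists (ts_poly q z zh h).
  exists h => // k; apply/is_signP; rewrite exprMn ts_sign_sqr mulr1.
  by apply/is_signP/e_sign/mem_nth; rewrite size_tuple lt_r0 // (s2valP (ts_index_surj k)).
apply/congrP => n ltn.
have ltx : (n %/ d < q)%N by rewrite ltn_divLR // mulnC -r_eq.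
have lty : (n %% d < d)%N by rewrite ltn_mod.
rewrite (divn_eq n d) mulnC blocks // ts_index_block hE // ts_sign_block.
by rewrite mulrACA -expr2 ts_sign_sqr mulr1 mulrC.
Qed.

End TonelliShanksValues.

(** * Specialization to the prime field *)

Theorem proposition5p7 (p s q r d : nat)
    (hp : prime p) (hp_odd : odd p)
    (hpsq : p.-1 = (2 ^ s * q)%N) (hq : odd q)
    (hr : r = p.-1./2) (hd : d = (2 ^ s.-1)%N)
    (zeta zetah : 'F_p)
    (hzeta : d.-primitive_root zeta) (hzetah : zetah ^+ 2 = zeta)
    (gamma : {unit 'F_p}) (hgamma : generator [set: {unit 'F_p}] gamma)
    (e : r.-tuple 'F_p) (he : sign_vector e)
    (f : {poly 'F_p}) (hf : interpolant (val gamma) e f) :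
  (tonelli_shanks_mod d q zeta zetah r f <-> alternating_order e = d)
  /\ (tonelli_shanks_mod d q zeta zetah r f <->
      forall x y : nat, (x < q)%N -> (y < d)%N ->
        e`_(d * x + y) = (-1) ^+ x * e`_y).
Proof.
(* For [s = 0], [p - 1 = q] would be odd and [p] even. *)
have s_gt0 : (0 < s)%N.
  case: (s) hpsq => // p1_eq; move: hp_odd.
  by rewrite -(prednK (prime_gt0 hp)) p1_eq mul1n /= hq.
have p1_eq : p.-1 = (2 * (d * q))%N by rewrite hpsq hd mulnA -expnS prednK.
have r_eq : r = (d * q)%N by rewrite hr p1_eq mul2n doubleK.
have r_gt0 : (0 < r)%N.
  by rewrite r_eq hd muln_gt0 expn_gt0; case: (q) hq.
have gamma_prim : (2 * r).-primitive_root (val gamma).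
  have gamma_order : #[gamma]%g = (2 * r)%N.
    rewrite /order; move: hgamma => /eqP <-.
    by rewrite card_finField_unit card_Fp // p1_eq r_eq.
  rewrite -gamma_order /primitive_root_of_unity order_gt0.
  apply/forallP => i; rewrite unity_rootE -FinRing.val_unitX -[1]/(val (1%g : {unit 'F_p})).
  rewrite val_eqE -order_dvdn; apply/eqP; apply/idP/eqP => [dvd | -> //].
  by apply/eqP; rewrite eqn_leq ltn_ord dvdn_leq.
have block := tonelli_shanks_modP hzeta hzetah gamma_prim r_eq hq he hf.
split=> //; apply: iff_trans block _; apply: iff_sym.
rewrite hd in r_eq *.
apply: iff_trans (flip_ext_antiperiodP e r_gt0 r_eq hq).
apply: (@alternating_orderP _ r e r_gt0 s q) => //.
(* Here [-1 = gamma^r], which differs from 1 because [gamma] has order [2r]. *)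
have neq1 : (1 : 'F_p) != -1.
  rewrite -(gen_expr_half gamma_prim) eq_sym -(prim_order_dvd gamma_prim).
  by rewrite gtnNdvd // ltn_Pmull.
have [|->|->] := he e`_0; first by rewrite mem_nth // size_tuple.
  by [].
by rewrite opprK eq_sym.
Qed.
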